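(* Let $L$ be a regular Lagrangian on $TQ$, $J$ a type $(1,1)$ tensor field on $Q$, and let $R$ be the type $(1,1)$ tensor field on $TQ$ defined by $i_{R(\xi)}\,d d_S L = i_\xi\, d d_{J^cS}L$ for all vector fields $\xi$ on $TQ$. Let $\tilde J$ be the complete lift of $J$ to $T^*Q$ and $Leg:TQ\to T^*Q$ the Legendre transform of $L$. Then $$R = Leg^*\tilde J .$$
   Context: $Q$ is a smooth $n$-dimensional manifold, $TQ$ has natural coordinates $(q^i,u^i)$ and $T^*Q$ has natural coordinates $(q^i,p_i)$. $L\in C^\infty(TQ)$ is regular: the Hessian $\partial^2L/\partial u^i\partial u^j$ is everywhere non-singular. $S=\frac{\partial}{\partial u^i}\otimes dq^i$ is the vertical endomorphism. A type $(1,1)$ tensor field $K$ acts on 1-forms by $(K\alpha)(\xi)=\alpha(K\xi)$, and $d_KL:=K(dL)=dL\circ K$. The 2-form $\omega_L=dd_SL$ is symplectic. The complete lift $J^c$ of $J$ to $TQ$ is the type $(1,1)$ tensor field with $J^c(X^c)=(JX)^c$, $J^c(X^V)=(JX)^V$ for vector fields $X$ on $Q$, where $X^c$, $X^V$ are the complete and vertical lifts of $X$ to $TQ$; $J^cS$ is the composition of endomorphisms. $Leg:(q^i,u^i)\mapsto(q^i,p_i=\partial L/\partial u^i)$ is a local diffeomorphism, and $Leg^*T$ for a type $(1,1)$ tensor field $T$ on $T^*Q$ is the field $(Leg_* )^{-1}\circ T\circ Leg_*$ (pointwise). The complete lift $\tilde J$ of $J$ to $T^*Q$ is defined by $i_{\tilde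 J\xi}d\theta=i_\xi\,\mathcal{L}_{J^v}d\theta$ for all vector fields $\xi$ on $T^*Q$, where $\theta=p_idq^i$ is the canonical 1-form and $J^v=p_kJ^k_j\frac{\partial}{\partial p_j}$ is the vertical lift of $J$, a vector field on $T^*Q$. *)

(* Defs.v *)
From HB Require Import structures.
From mathcomp Require Import all_boot all_order all_algebra.
From mathcomp Require Import all_classical all_reals all_analysis.
Set Implicit Arguments.
Unset Strict Implicit.
Unset Printing Implicit Defensive.
Import Order.TTheory GRing.Theory Num.Theory.
Import numFieldNormedType.Exports.
Local Open Scope classical_set_scope.
Local Open Scope ring_scope.

(* Conventions.  Coordinates, vectors and components of vector fields are row
   vectors; covectors and 1-forms are column vectors, paired with vectors by
   [v *m p].  A type (1,1) tensor K acts on vectors by [v |-> v *m K], so row i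
   of K is the image of the i-th coordinate vector, the (1,1) tensor K1 o K2 is
   [K2 *m K1], and K acts on a covector p by [K *m p].  A 2-form w is the
   matrix with entries w(d_i, d_j), so that w(v, v') = v *m w *m v'^T. *)

Fixpoint Ck (R : realType) (V W : normedModType R) (k : nat) (U : set V)
    (f : V -> W) : Prop :=
  if k is k'.+1 then
    (forall x, U x -> differentiable f x) /\ (forall v : V, Ck k' U ('D_v f))
  else forall x, U x -> continuous_at x f.

Definition smooth_on (R : realType) (V W : normedModType R) (U : set V)
    (f : V -> W) : Prop :=
  forall k, Ck k U f.

Definition partial (R : realType) (m : nat) (W : normedModType R) (i : 'I_m)
    (f : 'rV[R]_m -> W) : 'rV[R]_m -> W :=
  'D_(delta_mx 0 i) f.

(* Only [coord a x] with [x] in [dom a] is meaningful. *)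
Record atlas (R : realType) (M : Type) (m : nat) := Atlas {
  chart : Type;
  dom : chart -> set M;
  coord : chart -> M -> 'rV[R]_m
}.

Section Atlas.
Context {R : realType} {M : Type} {m : nat} (A : atlas R M m).

Definition coord_range (a : chart A) : set 'rV[R]_m := coord a @` dom a.

(* f o (coord a)^-1, with a default value outside [coord_range a]. *)
Definition localrep (T : pointedType) (f : M -> T) (a : chart A)
    (z : 'rV[R]_m) : T :=
  get [set f x | x in [set x | dom a x /\ coord a x = z]].

Definition overlap (a b : chart A) : set 'rV[R]_m :=
  coord a @` (dom a `&` dom b).

Definition transition (a b : chart A) : 'rV[R]_m -> 'rV[R]_m :=
  localrep (coord b) a.

Definition smooth_function (f : M -> R) : Prop :=
  forall a, smooth_on (coord_range a) (localrep f a).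

(* Tensor fields are given by their components in every chart [a], as functions
   of the coordinates of [a]; values outside [coord_range a] are irrelevant. *)
Definition vfield := chart A -> 'rV[R]_m -> 'rV[R]_m.
Definition form1 := chart A -> 'rV[R]_m -> 'cV[R]_m.
Definition form2 := chart A -> 'rV[R]_m -> 'M[R]_m.
Definition tensor11 := chart A -> 'rV[R]_m -> 'M[R]_m.

Definition same_field (k l : nat)
    (s t : chart A -> 'rV[R]_m -> 'M[R]_(k, l)) : Prop :=
  forall a z, coord_range a z -> s a z = t a z.

Definition is_vfield (X : vfield) : Prop :=
  (forall a, smooth_on (coord_range a) (X a)) /\
  (forall a b z, overlap a b z ->
     X b (transition a b z) = X a z *m jacobian (transition a b) z).

Definition is_tensor11 (K : tensor11) : Prop :=
  (forall a, smooth_on (coord_range a) (K a)) /\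
  (forall a b z, overlap a b z ->
     K a z *m jacobian (transition a b) z =
     jacobian (transition a b) z *m K b (transition a b z)).

Definition apply11 (K : tensor11) (X : vfield) : vfield :=
  fun a z => X a z *m K a z.

Definition coapply11 (K : tensor11) (alpha : form1) : form1 :=
  fun a z => K a z *m alpha a z.

Definition comp11 (K1 K2 : tensor11) : tensor11 :=
  fun a z => K2 a z *m K1 a z.

Definition d0 (f : M -> R) : form1 :=
  fun a z => \col_i partial i (localrep f a) z.

Definition dK (K : tensor11) (f : M -> R) : form1 := coapply11 K (d0 f).

Definition d1 (alpha : form1) : form2 :=
  fun a z => \matrix_(i, j) (partial i (fun y => alpha a y j 0) z
                             - partial j (fun y => alpha a y i 0) z).

Definition contract2 (X : vfield) (w : form2) : form1 :=
  fun a z => (X a z *m w a z)^T.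

Definition lie2 (X : vfield) (w : form2) : form2 :=
  fun a z => \matrix_(i, j) \sum_k
    (X a z 0 k * partial k (fun y => w a y i j) z
     + w a z k j * partial i (fun y => X a y 0 k) z
     + w a z i k * partial j (fun y => X a y 0 k) z).

(* Tangent vectors: compatible families of components in the charts around the
   base point.  The other components are set to 0, so that equality of tangent
   vectors is Leibniz equality. *)
Record tangent := Tangent {
  tbase : M;
  tcomp : chart A -> 'rV[R]_m;
  tcompE : forall a b, dom a tbase -> dom b tbase ->
    tcomp b = tcomp a *m jacobian (transition a b) (coord a tbase);
  tcomp_out : forall a, ~ dom a tbase -> tcomp a = 0
}.

Record cotangent := Cotangent {
  cbase : M;
  ccomp : chart A -> 'cV[R]_m;
  ccompE : forall a b, dom a cbase -> dom b cbase ->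
    ccomp a = jacobian (transition a b) (coord a cbase) *m ccomp b;
  ccomp_out : forall a, ~ dom a cbase -> ccomp a = 0
}.

Definition tangent_atlas : atlas R tangent (m + m) :=
  {| chart := chart A;
     dom := fun a t => dom a (tbase t);
     coord := fun a t => row_mx (coord a (tbase t)) (tcomp t a) |}.

Definition cotangent_atlas : atlas R cotangent (m + m) :=
  {| chart := chart A;
     dom := fun a p => dom a (cbase p);
     coord := fun a p => row_mx (coord a (cbase p)) (ccomp p a)^T |}.

End Atlas.

Arguments smooth_function {R M m} A f.

Definition smooth_manifold (R : realType) (Q : topologicalType) (n : nat)
    (A : atlas R Q n) : Prop :=
  [/\ hausdorff_space Q /\ @second_countable Q,
      forall x, exists a : chart A, dom a x,
      forall a : chart A, open (dom a) /\ set_inj (dom a) (coord a),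
      forall (a : chart A) (W : set Q), W `<=` dom a ->
        (open W <-> open (coord a @` W)) &
      forall a b : chart A, smooth_on (overlap a b) (transition a b)].

Section TangentBundle.
Context {R : realType} {Q : Type} {n : nat} {A : atlas R Q n}.
Local Notation TQ := (tangent_atlas A).

Definition vertical_endo : tensor11 TQ :=
  fun _ _ => block_mx 0 1%:M 0 0.

(* X^V = X^i d/du^i *)
Definition vlift (X : vfield A) : vfield TQ :=
  fun a z => row_mx 0 (X a (lsubmx z)).

(* X^c = X^i d/dq^i + u^j (dX^i/dq^j) d/du^i *)
Definition clift (X : vfield A) : vfield TQ :=
  fun a z => row_mx (X a (lsubmx z)) ('D_(rsubmx z) (X a) (lsubmx z)).

Definition is_tangent_clift (J : tensor11 A) (Jc : tensor11 TQ) : Prop :=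
  is_tensor11 Jc /\
  forall X, is_vfield X ->
    same_field (apply11 Jc (clift X)) (clift (apply11 J X)) /\
    same_field (apply11 Jc (vlift X)) (vlift (apply11 J X)).

Definition fibre_derivative (L : tangent A -> R) (a : chart A)
    (z : 'rV[R]_(n + n)) : 'cV[R]_n :=
  \col_i partial (rshift n i) (localrep L (a : chart TQ)) z.

Definition fibre_hessian (L : tangent A -> R) (a : chart A)
    (z : 'rV[R]_(n + n)) : 'M[R]_n :=
  \matrix_(i, j) partial (rshift n i)
    (partial (rshift n j) (localrep L (a : chart TQ))) z.

Definition regular (L : tangent A -> R) : Prop :=
  forall (a : chart TQ) z, coord_range a z -> fibre_hessian L a z \in unitmx.

End TangentBundle.

Section CotangentBundle.
Context {R : realType} {Q : Type} {n : nat} {A : atlas R Q n}.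
Local Notation TQ := (tangent_atlas A).
Local Notation T'Q := (cotangent_atlas A).

Definition canonical_form : form1 T'Q :=
  fun _ z => col_mx (rsubmx z)^T 0.

(* The p_j-component of J^v is p_k J^k_j, where J^k_j is [J a q j k]. *)
Definition covlift (J : tensor11 A) : vfield T'Q :=
  fun a z => row_mx 0 (rsubmx z *m (J a (lsubmx z))^T).

Definition is_cotangent_clift (J : tensor11 A) (Jt : tensor11 T'Q) : Prop :=
  is_tensor11 Jt /\
  forall xi, is_vfield xi ->
    same_field (contract2 (apply11 Jt xi) (d1 canonical_form))
               (contract2 xi (lie2 (covlift J) (d1 canonical_form))).

(* Determines Leg, since a covector is determined by its base point and its
   components in one chart. *)
Definition is_legendre (L : tangent A -> R) (Leg : tangent A -> cotangent A) :
    Prop :=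
  forall t, cbase (Leg t) = tbase t /\
    forall a : chart A, dom a (tbase t) ->
      ccomp (Leg t) a = fibre_derivative L a (coord (a : chart TQ) t).

Definition bundle_localrep (F : tangent A -> cotangent A) (a : chart A) :
    'rV[R]_(n + n) -> 'rV[R]_(n + n) :=
  localrep (fun t => coord (a : chart T'Q) (F t)) (a : chart TQ).

(* F^* T = (F_* )^-1 o T o F_*, for F a local diffeomorphism over the identity
   of Q, so that F maps the domain of the chart of TQ induced by a chart of Q
   to the domain of the chart of T*Q induced by the same chart. *)
Definition pullback11 (F : tangent A -> cotangent A) (T : tensor11 T'Q) :
    tensor11 TQ :=
  fun a z => let D := jacobian (bundle_localrep F a) z in
    D *m T a (bundle_localrep F a z) *m invmx D.

End CotangentBundle.

(* Main.v *)
From HB Require Import structures.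
From mathcomp Require Import all_boot all_order all_algebra.
From mathcomp Require Import all_classical all_reals all_analysis.
From mathcomp Require Import ring.
Require Import Defs.
Set Implicit Arguments.
Unset Strict Implicit.
Unset Printing Implicit Defensive.
Import Order.TTheory GRing.Theory Num.Theory.
Import numFieldNormedType.Exports.
Local Open Scope classical_set_scope.
Local Open Scope ring_scope.

(** In the chart of TQ induced by a chart of Q let P be the fibre derivative
    dL/du, so that Leg reads phi (q, u) = (q, P (q, u)).  The two 1-forms that
    define R are semibasic: d_S L = P_i dq^i, and d_{J^c S} L = (J P)_i dq^i
    because J^c S sees J^c on vertical vectors only.  They are the pullbacks by
    phi of the canonical form theta = p_i dq^i and of (J p)_i dq^i, and the
    latter is i_{J^v} d theta, so that its differential is L_{J^v} d theta.
    As d commutes with pullbacks, the equation that defines R is the pullback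
    of the one that defines the lift of J to T*Q; both have a single solution
    because d theta is non-degenerate and, L being regular, phi is a local
    diffeomorphism.

    In matrices, let D be the Jacobian of phi, W the matrix of d theta and
    Lambda the one of L_{J^v} d theta.  The second derivatives of L are the
    blocks of D, and a block computation ([block_symplectic_pullback], fed by
    [d_dS], [d_dJcS], [d_canonical_form] and [lie_canonical_form]) gives
    D W D^T for d d_S L and D Lambda D^T for d d_{J^c S} L.  Hence
    R D W D^T = D Lambda D^T = D Jt W D^T, and D, W are invertible.

    The defining equations are only assumed for global smooth vector fields,
    whereas this argument is pointwise, so a smooth field must be found through
    every tangent vector, up to a nonzero factor.  It is a constant field in a
    chart times a function supported in that chart, extended by zero
    ([cutoff_field], [eq_on_vfields]).  On Q the function comes from
    exp (- 1 / x) ([manifold_cutoff]); that the extension by zero is smooth is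
    where Q must be Hausdorff ([near_outside_chart_compact]).  TQ and T*Q are
    both instances of a vector bundle given by a smooth cocycle, to which
    smoothness of the atlas and cut-off functions lift from Q
    ([smooth_bundle_atlas], [bundle_cutoff]). *)

(** * Calculus of class C^k maps *)

Section SmoothCalculus.
Context {R : realType}.
Implicit Types V W : normedModType R.

(** The difference g - f vanishes near x, hence has zero differential there. *)
Lemma near_eq_differentiable V W (f g : V -> W) x :
  (\near x, f x = g x) -> differentiable f x -> differentiable g x.
Proof.
move=> fg df; pose h := g \- f.
have h0 : \forall y \near x, h y = 0.
  by apply: filterS fg => y fgy; rewrite /h /= fgy subrr.
have hx : h x = 0 by exact: nbhs_singleton h0.
have ho : h \o shift x = cst (h x) + (\0 : V -> W) +o_ 0 id.
  apply/eqaddoP => _/posnumP[e]; rewrite hx.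
  move: h0; rewrite (near_shift 0) subr0 => h0; near=> y.
  rewrite /= !fctE /= (_ : h (y + x) = 0) ?addr0 ?subr0 ?normr0 ?mulr_ge0//.
  by near: y.
have dh0 : 'd h x = (\0 : V -> W) :> (V -> W).
  by apply: diff_unique ho => y; exact: cvg_cst.
have dh : differentiable h x.
  by apply/diff_locallyP; rewrite dh0; split=> // y; exact: cvg_cst.
have -> : g = f + h by apply/funext => y; rewrite /h fctE /= addrC subrK.
exact: differentiableD.
Unshelve. all: by end_near. Qed.

(** [Ck] looks at derivatives at the points of U only, so that
    the values on U determine it only because U is open. *)
Lemma Ck_ext k V W (U : set V) (f g : V -> W) : open U ->
  (forall x, U x -> f x = g x) -> Ck k U f -> Ck k U g.
Proof.
move=> oU; elim: k f g => [|k IH] f g fg /=.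
  move=> cf x Ux; rewrite /continuous_at -(fg x Ux).
  apply: cvg_trans (cf x Ux); apply: near_eq_cvg.
  by apply: filterS (open_nbhs_nbhs (conj oU Ux)) => y /fg.
have nfg x : U x -> \near x, f x = g x.
  by move=> Ux; apply: filterS (open_nbhs_nbhs (conj oU Ux)) => y /fg.
move=> [df dDf]; split=> [x Ux|v].
  exact: near_eq_differentiable (nfg _ Ux) (df _ Ux).
by apply: IH (dDf v) => x Ux; exact/near_eq_derive/nfg.
Qed.

Lemma CkW k V W (U : set V) (f : V -> W) : Ck k.+1 U f -> Ck k U f.
Proof.
elim: k f => [|k IH] f [df Df].
  by move=> x Ux; exact/differentiable_continuous/df.
by split=> // v; exact/IH/Df.
Qed.

Lemma Ck_local k V W (U : set V) (f : V -> W) :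
  (forall x, U x -> exists2 O, O x & Ck k O f) -> Ck k U f.
Proof.
elim: k f => [|k IH] f H /=.
  by move=> x /H[ O Ox]; apply.
split=> [x /H[ O Ox [df _]]|v]; first exact: df.
by apply: IH => x /H[ O Ox [_ Df]]; exists O => //; exact: Df.
Qed.

Lemma Ck_sub k V W (U O : set V) (f : V -> W) :
  U `<=` O -> Ck k O f -> Ck k U f.
Proof. by move=> sUO cf; apply: Ck_local => x /sUO Ox; exists O. Qed.

Lemma Ck_cst k V W (U : set V) (w : W) : Ck k U (cst w).
Proof.
elim: k w => [|k IH] w; first by move=> x _; exact: cvg_cst.
split=> [x _|v]; first exact: differentiable_cst.
by rewrite (_ : 'D_v _ = cst 0) // funeqE => x; rewrite derive_cst.
Qed.

Lemma Ck_id k V (U : set V) : Ck k U (@id V).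
Proof.
case: k => [|k]; first by move=> x _; exact: cvg_id.
split=> [x _|v]; first by apply: ex_diff.
rewrite (_ : 'D_v _ = cst v); first exact: Ck_cst.
by rewrite funeqE => x; rewrite derive_id.
Qed.

Lemma Ck_add k V W (U : set V) (f g : V -> W) : open U ->
  Ck k U f -> Ck k U g -> Ck k U (f \+ g).
Proof.
move=> oU; elim: k f g => [|k IH] f g.
  by move=> cf cg x Ux; exact: continuousD (cf x Ux) (cg x Ux).
move=> [df Df] [dg Dg]; split=> [x Ux|v].
  exact: differentiableD (df x Ux) (dg x Ux).
apply: (Ck_ext oU _ (IH _ _ (Df v) (Dg v))) => x Ux /=.
by rewrite deriveD//; apply: diff_derivable; [exact: df|exact: dg].
Qed.

Lemma Ck_sum k V W (U : set V) (I : Type) (r : seq I) (f : I -> V -> W) :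
  open U -> (forall i, Ck k U (f i)) -> Ck k U (fun x => \sum_(i <- r) f i x).
Proof.
move=> oU cf; elim: r => [|i r IH].
  by under eq_fun do rewrite big_nil; exact: Ck_cst.
by under eq_fun do rewrite big_cons; exact: Ck_add.
Qed.

Lemma Ck_linear k V W W' (U : set V) (l : {linear W -> W'}) (f : V -> W) :
  open U -> continuous l -> Ck k U f -> Ck k U (l \o f).
Proof.
move=> oU cl; elim: k f => [|k IH] f.
  by move=> cf x Ux; exact: continuous_comp (cf x Ux) (cl _).
move=> [df Df]; split=> [x Ux|v].
  apply: differentiable_comp; first exact: df.
  exact: linear_differentiable.
apply: (Ck_ext oU _ (IH _ (Df v))) => x Ux /=.
have dl : differentiable l (f x) by exact: linear_differentiable.
have dlf : differentiable (l \o f) x := differentiable_comp (df x Ux) dl.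
by rewrite (deriveE _ dlf) diff_comp//= ?diff_lin ?deriveE//; exact: df.
Qed.

Lemma Ck_mul k V (U : set V) (f g : V -> R) : open U ->
  Ck k U f -> Ck k U g -> Ck k U (fun x => f x * g x).
Proof.
move=> oU; elim: k f g => [|k IH] f g.
  by move=> cf cg x Ux; exact: continuousM (cf x Ux) (cg x Ux).
move=> [df Df] [dg Dg]; split=> [x Ux|v].
  exact: differentiableM (df x Ux) (dg x Ux).
have Hf := CkW (conj df Df); have Hg := CkW (conj dg Dg).
have Hfg := Ck_add oU (IH _ _ Hf (Dg v)) (IH _ _ Hg (Df v)).
apply: (Ck_ext oU _ Hfg) => x Ux /=.
by rewrite deriveM//; apply: diff_derivable; [exact: df|exact: dg].
Qed.

(** Reduces matrix-valued maps to scalar ones, for which products and chain rule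
    are available: a matrix is the sum of its entries times the elementary ones,
    and both passages are continuous linear maps. *)
Lemma Ck_mxP k V (U : set V) p q (F : V -> 'M[R]_(p, q)) : open U ->
  Ck k U F <-> forall i j, Ck k U (fun x => F x i j).
Proof.
move=> oU; split=> [cF i j|cF].
  have lin : linear (fun N : 'M[R]_(p, q) => N i j : R^o).
    by move=> a M N; rewrite !mxE.
  pose l : {linear 'M[R]_(p, q) -> R^o} :=
    HB.pack (fun N : 'M[R]_(p, q) => N i j)
      (GRing.isLinear.Build _ _ _ _ _ lin).
  exact: (Ck_linear (l := l) oU (@coord_continuous _ _ _ i j) cF).
rewrite (_ : F = fun x => \sum_i \sum_j F x i j *: delta_mx i j); last first.
  by apply/funext => x; exact: matrix_sum_delta.
apply: Ck_sum => // i; apply: Ck_sum => // j.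
pose d := (delta_mx i j : 'M[R]_(p, q)).
have lin : linear ( *:%R^~ d : R^o -> _).
  by move=> a b c; rewrite scalerDl scalerA.
pose l : {linear R^o -> 'M[R]_(p, q)} :=
  HB.pack ( *:%R^~ d) (GRing.isLinear.Build _ _ _ _ _ lin).
apply: (Ck_linear (l := l) oU _ (cF i j)).
exact: scalel_continuous.
Qed.

End SmoothCalculus.

(** * Smooth matrix-valued maps and Jacobians *)

Section SmoothMaps.
Context {R : realType}.
Implicit Types V W : normedModType R.

(** By induction on the order: the derivative of g o f along v is the sum over i
    of (D_v f)_i times (D_{e_i} g) o f, whose factors are smooth again. *)
Lemma smooth_comp_scalar V p (U : set V) (O : set 'rV[R]_p)
    (f : V -> 'rV[R]_p) (g : 'rV[R]_p -> R) : open U ->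
  (forall x, U x -> O (f x)) -> smooth_on U f -> smooth_on O g ->
  smooth_on U (g \o f).
Proof.
move=> oU fUO sf sg k; elim: k g sg => [|k IH] g sg.
  by move=> x Ux; apply: continuous_comp; [exact: (sf 0%N)|exact/(sg 0%N)/fUO].
have df x : U x -> differentiable f x by case: (sf 1%N) => + _; apply.
have dg x : O x -> differentiable g x by case: (sg 1%N) => + _; apply.
split=> [x Ux|v].
  by apply: differentiable_comp; [exact: df|exact/dg/fUO].
pose t i x := 'D_v f x 0 i * ('D_(delta_mx 0 i) g \o f) x.
apply: (@Ck_ext _ _ _ _ _ (fun x => \sum_i t i x)) => // [x Ux|].
  have dgf : differentiable (g \o f) x.
    by apply: differentiable_comp; [exact: df|exact/dg/fUO].
  rewrite deriveE// diff_comp/=; [|exact: df|exact/dg/fUO].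
  rewrite -(deriveE v (df x Ux)).
  rewrite [in RHS](row_sum_delta ('D_v f x)) linear_sum; apply: eq_bigr => i _.
  by rewrite linearZ /t /= -deriveE//; exact/dg/fUO.
apply: Ck_sum => // i; apply: Ck_mul => //.
  by have [_ /(_ v)/(Ck_mxP _ _ oU)] := sf k.+1; apply.
by apply: IH => j; have [_] := sg j.+1; apply.
Qed.

Lemma smooth_mxP V (U : set V) p q (F : V -> 'M[R]_(p, q)) : open U ->
  smooth_on U F <-> forall i j, smooth_on U (fun x => F x i j).
Proof.
move=> oU; split=> [sF i j k|sF k]; first exact: (Ck_mxP _ _ oU).1 (sF k) i j.
by apply/Ck_mxP => // i j; exact: sF.
Qed.

Lemma smooth_comp V p q r (U : set V) (O : set 'rV[R]_p)
    (f : V -> 'rV[R]_p) (g : 'rV[R]_p -> 'M[R]_(q, r)) : open U -> open O ->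
  (forall x, U x -> O (f x)) -> smooth_on U f -> smooth_on O g ->
  smooth_on U (g \o f).
Proof.
move=> oU oO fUO sf sg; apply/smooth_mxP => // i j.
exact: smooth_comp_scalar oU fUO sf ((smooth_mxP _ oO).1 sg i j).
Qed.

Lemma smooth_ext V W (U : set V) (f g : V -> W) : open U ->
  (forall x, U x -> f x = g x) -> smooth_on U f -> smooth_on U g.
Proof. by move=> oU fg sf k; exact: Ck_ext (sf k). Qed.

Lemma smooth_differentiable V W (U : set V) (f : V -> W) x :
  smooth_on U f -> U x -> differentiable f x.
Proof. by move=> /(_ 1%N)[df _]; exact: df. Qed.

Lemma smooth_derive V W (U : set V) (f : V -> W) v :
  smooth_on U f -> smooth_on U ('D_v f).
Proof. by move=> sf k; have [_] := sf k.+1; apply. Qed.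

Lemma smooth_mulmx V (U : set V) p q r (F : V -> 'M[R]_(p, q))
    (G : V -> 'M[R]_(q, r)) : open U ->
  smooth_on U F -> smooth_on U G -> smooth_on U (fun x => F x *m G x).
Proof.
move=> oU /(smooth_mxP _ oU) sF /(smooth_mxP _ oU) sG.
apply/smooth_mxP => // i j k.
under eq_fun do rewrite mxE.
by apply: Ck_sum => // l; apply: Ck_mul => //; [exact: sF|exact: sG].
Qed.

Lemma smooth_scale V (U : set V) p q (h : V -> R) (G : V -> 'M[R]_(p, q)) :
  open U -> smooth_on U h -> smooth_on U G -> smooth_on U (fun x => h x *: G x).
Proof.
move=> oU sh /(smooth_mxP _ oU) sG; apply/smooth_mxP => // i j k.
under eq_fun do rewrite mxE.
exact: Ck_mul oU (sh k) (sG i j k).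
Qed.

Lemma smooth_trmx V (U : set V) p q (F : V -> 'M[R]_(p, q)) : open U ->
  smooth_on U F -> smooth_on U (fun x => (F x)^T).
Proof.
move=> oU /(smooth_mxP _ oU) sF; apply/smooth_mxP => // i j k.
under eq_fun do rewrite mxE.
exact: sF.
Qed.

Lemma smooth_row_mx V (U : set V) p q r (F : V -> 'M[R]_(p, q))
    (G : V -> 'M[R]_(p, r)) : open U ->
  smooth_on U F -> smooth_on U G -> smooth_on U (fun x => row_mx (F x) (G x)).
Proof.
move=> oU /(smooth_mxP _ oU) sF /(smooth_mxP _ oU) sG.
apply/smooth_mxP => // i j k; under eq_fun do rewrite mxE.
by case: (fintype.split j) => l; [exact: sF|exact: sG].
Qed.

Lemma smooth_lsubmx p q (U : set 'rV[R]_(p + q)) : open U ->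
  smooth_on U (lsubmx : 'rV[R]_(p + q) -> 'rV[R]_p).
Proof.
move=> oU k; exact: (Ck_linear (l := lsubmx) oU (@continuous_lsubmx _ _ _ _)
  (@Ck_id _ k _ U)).
Qed.

Lemma smooth_rsubmx p q (U : set 'rV[R]_(p + q)) : open U ->
  smooth_on U (rsubmx : 'rV[R]_(p + q) -> 'rV[R]_q).
Proof.
move=> oU k; exact: (Ck_linear (l := rsubmx) oU (@continuous_rsubmx _ _ _ _)
  (@Ck_id _ k _ U)).
Qed.

Lemma row_jacobian m p (f : 'rV[R]_m -> 'rV[R]_p) x i :
  differentiable f x -> row i (jacobian f x) = partial i f x.
Proof. by move=> df; rewrite /partial deriveEjacobian// -rowE. Qed.

Lemma smooth_jacobian m p (U : set 'rV[R]_m) (f : 'rV[R]_m -> 'rV[R]_p) :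
  open U -> smooth_on U f -> smooth_on U (jacobian f).
Proof.
move=> oU sf; apply/smooth_mxP => // i j.
have /(smooth_mxP _ oU) := @smooth_derive _ _ _ _ (delta_mx 0 i) sf.
move=> /(_ 0 j); apply: smooth_ext => // x Ux.
have := row_jacobian i (smooth_differentiable sf Ux).
by move=> /(congr1 (fun M : 'rV_p => M 0 j)); rewrite mxE.
Qed.

Lemma jacobian_comp m p q (f : 'rV[R]_m -> 'rV[R]_p)
    (g : 'rV[R]_p -> 'rV[R]_q) x :
  differentiable f x -> differentiable g (f x) ->
  jacobian (g \o f) x = jacobian f x *m jacobian g (f x).
Proof.
move=> df dg.
have dgf : differentiable (g \o f) x by exact: differentiable_comp.
apply/row_matrixP => i; rewrite row_mul !row_jacobian// /partial.
rewrite (deriveE _ dgf) diff_comp//= -(deriveE _ df) -(deriveE _ dg).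
by rewrite deriveEjacobian.
Qed.

Lemma jacobian_near m p (f g : 'rV[R]_m -> 'rV[R]_p) x :
  (\near x, f x = g x) -> differentiable f x -> jacobian f x = jacobian g x.
Proof.
move=> fg df; have dg := near_eq_differentiable fg df.
apply/row_matrixP => i; apply: etrans (row_jacobian i df) _.
by apply: etrans (esym (row_jacobian i dg)); exact: near_eq_derive.
Qed.

Lemma jacobian_id m (x : 'rV[R]_m) : jacobian (@id 'rV[R]_m) x = 1%:M.
Proof.
apply/row_matrixP => i; rewrite row_jacobian; last by apply: ex_diff.
by rewrite /partial derive_id row1.
Qed.

End SmoothMaps.

(** * A flat function on the line *)

Section Flat.
Context {R : realType}.
Implicit Types (x : R) (k : nat).

(** The powers of 1 / x make this family closed under differentiation, so that
    one induction gives the smoothness of all its members. *)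
Definition flat k x : R := if 0 < x then x^-1 ^+ k * expR (- x^-1) else 0.

Lemma flat_le0 k x : x <= 0 -> flat k x = 0.
Proof. by move=> x0; rewrite /flat ltNge x0. Qed.

(** For x > 0, exp (1 / x) exceeds the term of degree k + 1 of its series. *)
Lemma flat_bound k x : `|flat k x| <= (k.+1)`!%:R * `|x|.
Proof.
have [x0|x0] := lerP x 0; first by rewrite flat_le0// normr0 mulr_ge0.
have xV0 : 0 <= x^-1 by rewrite invr_ge0 ltW.
rewrite /flat x0 ger0_norm ?mulr_ge0 ?exprn_ge0 ?expR_ge0// (gtr0_norm x0).
have H : x^-1 ^+ k.+1 <= k.+1`!%:R * expR x^-1.
  rewrite mulrC -ler_pdivrMr ?ltr0n ?fact_gt0//.
  by apply: le_trans (expR_ge1Dxn k xV0); rewrite lerDr.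
rewrite expRN ler_pdivrMr ?expR_gt0//.
have -> : x^-1 ^+ k = x * x^-1 ^+ k.+1 by rewrite exprS mulVKf// gt_eqF.
by rewrite mulrAC mulrC ler_wpM2r// ltW.
Qed.

(** At 0, the difference quotient of [flat k] is [flat k.+1], which tends to 0
    by [flat_bound]. *)
Lemma is_derive_flat k x :
  is_derive x 1 (flat k) (flat k.+2 x - k%:R * flat k.+1 x).
Proof.
have [x0|x0|->] := ltgtP x 0.
- rewrite !flat_le0 ?ltW// mulr0 subr0.
  apply: (@near_eq_is_derive _ _ _ (cst 0)).
  have := lt_nbhsl x0; apply: filterS => y /ltW y0.
  by rewrite flat_le0.
- apply: (@near_eq_is_derive _ _ _
      ((fun y : R => y^-1) ^+ k * (expR \o (- (fun y : R => y^-1))))).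
    have := lt_nbhsr x0; apply: filterS => y y0.
    by rewrite /flat y0 [LHS]/(_ * _) /= exprfctE.
  rewrite /flat x0.
  have xn0 : x != 0 by rewrite gt_eqF.
  have d : is_derive x 1 (fun y : R => y^-1) (- x^-1 ^+ 2).
    apply: is_derive_eq (is_deriveV (f := id) xn0 (is_derive_id _ _)) _.
    by rewrite scaler1 exprVn.
  have dE : is_derive x 1 (expR \o (- (fun y : R => y^-1)))
      (expR (- x^-1) * x^-1 ^+ 2).
    by apply: is_derive_eq (is_derive1_comp _ _) _; rewrite opprK.
  apply: is_derive_eq.
  rewrite exprfctE /= /GRing.scale /=.
  case: k => [|k] /=; first by rewrite !mul0r; ring.
  rewrite -[(- _) x]/(- x^-1); move: (expR (- x^-1)) (x^-1) => E y.
  by rewrite !(exprS _ k.+2) !(exprS _ k.+1) !(exprS _ k); ring.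
- rewrite !flat_le0// mulr0 subr0.
  suff H : (fun h : R => h^-1 *: ((flat k \o shift 0) (h *: 1) - flat k 0)) @ 0^'
      --> (0 : R).
    by apply: DeriveDef; [apply/cvg_ex; exists 0|exact: cvg_lim H].
  apply/cvgr0Pnorm_le => _/posnumP[e]; near=> h.
  rewrite /= addr0 [_ *: 1]mulr1 (flat_le0 _ (lexx 0)) subr0.
  have -> : h^-1 *: flat k h = flat k.+1 h.
    rewrite /flat; case: ifP => h0; last by rewrite scaler0.
    by rewrite exprS -mulrA.
  apply: le_trans (flat_bound _ _) _.
  rewrite mulrC -ler_pdivlMr ?ltr0n ?fact_gt0//.
  by near: h; apply: dnbhs0_le; rewrite divr_gt0 ?ltr0n ?fact_gt0.
Unshelve. all: by end_near. Qed.

End Flat.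

(** The derivative of [flat k] involves the indices k + 1 and k + 2, hence the
    induction on the order for all k at once. *)
Lemma Ck_flat (R : realType) (V : normedModType R) (U : set V) (s : V -> R) j k :
  open U -> smooth_on U s -> Ck j U (flat k \o s).
Proof.
move=> oU ss.
have ds x : U x -> differentiable s x by exact: smooth_differentiable.
have df l (y : R) : differentiable (flat l) y.
  by apply/derivable1_diffP; have [] := is_derive_flat l y.
elim: j k => [|j IH] k.
  move=> x Ux; apply: differentiable_continuous.
  by apply: differentiable_comp; [exact: ds|exact: df].
split=> [x Ux|v].
  by apply: differentiable_comp; [exact: ds|exact: df].
pose t x := 'D_v s x * ((flat k.+2 \o s) x + (- k%:R) * (flat k.+1 \o s) x).
apply: (@Ck_ext _ _ _ _ _ t) => // [x Ux|].
  rewrite deriveE; last by apply: differentiable_comp; [exact: ds|exact: df].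
  rewrite diff_comp/=; [|exact: ds|exact: df].
  rewrite -(deriveE v (ds x Ux)) /t /=.
  rewrite -[X in 'd (flat k) _ X]mulr1 [RHS]linearZ; congr (_ *: _).
  by rewrite -deriveE// mulNr; have [_ ->] := is_derive_flat k (s x).
apply: Ck_mul => //; first exact: smooth_derive.
apply: Ck_add => //; apply: Ck_mul => //; exact: Ck_cst.
Qed.

(** * Smooth atlases and localized vector fields *)

Section AtlasTheory.
Context {R : realType} {M : Type} {m : nat} (A : atlas R M m).
Implicit Types (a b c : chart A) (x : M) (z : 'rV[R]_m).

(** A smooth structure expressed in coordinates only, as TQ and T*Q come without
    a topology. *)
Definition smooth_atlas : Prop :=
  [/\ forall a, set_inj (dom a) (coord a),
      forall a b, open (overlap a b) &
      forall a b, smooth_on (overlap a b) (transition a b)].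

(** The second clause, vanishing near every point outside the domain of a, is what
    makes the product of rho with a field on that domain extend smoothly by zero. *)
Definition cutoff (a : chart A) (rho : M -> R) : Prop :=
  smooth_function A rho /\
  forall b z, coord_range b z -> ~ overlap b a z ->
    \forall y \near z, localrep rho b y = 0.

(** The choice made by [localrep] is harmless as soon as f takes a single value
    on the points with coordinates z, such as the coordinates of Leg t, which
    depend on those of t only. *)
Lemma localrep_eq (T : pointedType) (f : M -> T) a z t :
  coord_range a z -> (forall x, dom a x -> coord a x = z -> f x = t) ->
  localrep f a z = t.
Proof.
move=> [x ax xz] ft.
have : [set f x | x in [set x | dom a x /\ coord a x = z]] (localrep f a z).
  by apply: getPex; exists (f x); exists x.
by move=> [y [ay yz] <-]; exact: ft.
Qed.

Lemma overlapxx a : overlap a a = coord_range a.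
Proof. by rewrite /overlap setIid. Qed.

Lemma overlap_sub a b : overlap a b `<=` coord_range a.
Proof. by move=> _ [x [ax _] <-]; exists x. Qed.

Hypothesis sA : smooth_atlas.

Lemma localrep_coord (T : pointedType) (f : M -> T) a x :
  dom a x -> localrep f a (coord a x) = f x.
Proof.
move=> ax; apply: localrep_eq; first by exists x.
case: sA => inj _ _; move=> y ay yx; congr f.
by apply: (inj a) => //; exact: mem_set.
Qed.

Lemma open_overlap a b : open (overlap a b).
Proof. by case: sA. Qed.

Lemma open_coord_range a : open (coord_range a).
Proof. by rewrite -overlapxx; exact: open_overlap. Qed.

Lemma overlap_coord a b x : dom a x -> overlap a b (coord a x) -> dom b x.
Proof.
case: sA => inj _ _ ax [y [ay yb] yx].
by rewrite -(inj a y x) // ?mem_set.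
Qed.

Lemma transition_coord a b x : dom a x -> transition a b (coord a x) = coord b x.
Proof. exact: localrep_coord. Qed.

Lemma smooth_transition a b : smooth_on (overlap a b) (transition a b).
Proof. by case: sA. Qed.

Lemma differentiable_transition a b z :
  overlap a b z -> differentiable (transition a b) z.
Proof. exact/smooth_differentiable/smooth_transition. Qed.

(** The chain rule: the three transition maps compose on the intersection of
    [overlap a b] and [overlap a c]. *)
Lemma jacobian_transition_cocycle a b c x : dom a x -> dom b x -> dom c x ->
  jacobian (transition a c) (coord a x) =
  jacobian (transition a b) (coord a x) *m jacobian (transition b c) (coord b x).
Proof.
move=> ax bx cx.
have oab : overlap a b (coord a x) by exists x.
have oac : overlap a c (coord a x) by exists x.
have obc : overlap b c (coord b x) by exists x.
have tx := transition_coord b ax.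
have dac := differentiable_transition oac.
have dab := differentiable_transition oab.
have dbc : differentiable (transition b c) (transition a b (coord a x)).
  by rewrite tx; exact: differentiable_transition.
rewrite -tx; apply: etrans (jacobian_comp dab dbc); apply: jacobian_near dac.
have nab := open_nbhs_nbhs (conj (@open_overlap a b) oab).
have nac := open_nbhs_nbhs (conj (@open_overlap a c) oac).
apply: filterS2 nab nac => _ [y [ay yb] <-].
move=> /(overlap_coord ay) yc /=.
by rewrite transition_coord// transition_coord// transition_coord.
Qed.

Lemma jacobian_transition_id a x : dom a x ->
  jacobian (transition a a) (coord a x) = 1%:M.
Proof.
move=> ax; rewrite -[RHS](jacobian_id (coord a x)); apply: jacobian_near.
  have : coord_range a (coord a x) by exists x.
  move=> /(conj (@open_coord_range a))/open_nbhs_nbhs.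
  by apply: filterS => _ [y ay <-]; rewrite transition_coord.
by apply: differentiable_transition; exists x.
Qed.

(** In the chart a this is rho times the constant field w; the Jacobian carries
    its values to the other charts. *)
Definition cutoff_field (a : chart A) (rho : M -> R) (w : 'rV[R]_m) : vfield A :=
  fun b => localrep (fun x => if `[< dom a x >] then
    rho x *: (w *m jacobian (transition a b) (coord a x)) else 0) b.

Lemma cutoff_field_in a b rho w x : dom b x -> dom a x ->
  cutoff_field a rho w b (coord b x) =
  rho x *: (w *m jacobian (transition a b) (coord a x)).
Proof.
move=> bx ax; apply: etrans (localrep_coord _ bx) _ => /=.
by rewrite asboolT.
Qed.

Lemma cutoff_field_out a b rho w x : dom b x -> (dom a x -> rho x = 0) ->
  cutoff_field a rho w b (coord b x) = 0.
Proof.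
move=> bx rx; apply: etrans (localrep_coord _ bx) _ => /=.
by case: asboolP => // /rx ->; rewrite scale0r.
Qed.

Lemma is_vfield_cutoff_field a rho w :
  cutoff a rho -> is_vfield (cutoff_field a rho w).
Proof.
move=> [srho rho0]; split=> [b k|b c _ [x [bx cx] <-]]; last first.
  rewrite (transition_coord c bx); have [ax|nax] := pselect (dom a x).
    apply: etrans (cutoff_field_in _ _ cx ax) _.
    rewrite (jacobian_transition_cocycle ax bx cx) mulmxA scalemxAl.
    by congr (_ *m _); exact: esym (cutoff_field_in _ _ bx ax).
  apply: etrans (cutoff_field_out _ cx _) _; first by move=> /nax.
  rewrite (_ : cutoff_field a rho w b (coord b x) = 0) ?mul0mx//.
  by apply: cutoff_field_out => // /nax.
apply: Ck_local => z bz; case: (pselect (overlap b a z)) => [oz|noz].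
  exists (overlap b a) => //.
  pose F y := localrep rho b y *:
    (w *m jacobian (transition a b) (transition b a y)).
  apply: (@smooth_ext _ _ _ _ F _ (@open_overlap b a)) => [_ [x [bx ax] <-]|].
    rewrite /F (transition_coord a bx) (localrep_coord rho bx).
    exact: esym (cutoff_field_in _ _ bx ax).
  apply: smooth_scale (@open_overlap b a) _ _.
    by move=> j; apply: Ck_sub (@overlap_sub b a) (srho b j).
  apply: smooth_mulmx (@open_overlap b a) _ _; first by move=> j; exact: Ck_cst.
  apply: (smooth_comp (@open_overlap b a) (@open_overlap a b)).
  - by move=> _ [x [bx ax] <-]; rewrite transition_coord//; exists x.
  - exact: smooth_transition.
  - exact/smooth_jacobian/smooth_transition/open_overlap.
have := rho0 b z bz noz; rewrite -nbhs_nearE nbhsE => -[ O [oO Oz] O0].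
have oOb := openI oO (@open_coord_range b).
exists (O `&` coord_range b) => //.
apply: (@Ck_ext _ _ _ _ _ (cst 0)) => // [y [Oy [x bx xy]]|]; last exact: Ck_cst.
have := O0 _ Oy; rewrite -xy (localrep_coord rho bx) => rx.
by apply: esym; exact: cutoff_field_out.
Qed.

Lemma cutoff_fieldE a rho w x : dom a x ->
  cutoff_field a rho w a (coord a x) = rho x *: w.
Proof.
move=> ax; apply: etrans (cutoff_field_in _ _ ax ax) _.
by rewrite jacobian_transition_id// mulmx1.
Qed.

(** Turns an identity tested on global vector fields into an identity of
    matrices at one point. *)
Lemma eq_on_vfields a x rho p (K1 K2 : 'M[R]_(m, p)) :
  dom a x -> cutoff a rho -> rho x != 0 ->
  (forall X : vfield A, is_vfield X ->
     X a (coord a x) *m K1 = X a (coord a x) *m K2) ->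
  K1 = K2.
Proof.
move=> ax crho rx K12; apply/row_matrixP => i; rewrite !rowE.
have := K12 _ (is_vfield_cutoff_field (delta_mx 0 i) crho).
by rewrite cutoff_fieldE// -!scalemxAl => /(scalerI rx).
Qed.

End AtlasTheory.

(** * Cut-off functions on a Hausdorff manifold *)

Lemma smooth_manifold_atlas (R : realType) (Q : topologicalType) n
  (A : atlas R Q n) : smooth_manifold A -> smooth_atlas A.
Proof.
move=> [_ _ oinj opn tr]; split=> // [a|a b]; first by case: (oinj a).
apply/(opn a); first exact: subIsetl.
by apply: openI; [case: (oinj a)|case: (oinj b)].
Qed.

Section Cutoff.
Context {R : realType} {n : nat} (c : 'rV[R]_n) (e : R).

(** Positive exactly on the open Euclidean ball of radius e around c, which lies
    in the closed cube of half-side e, a compact set. *)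
Definition gauge (z : 'rV[R]_n) : R := e ^+ 2 - \sum_i (z 0 i - c 0 i) ^+ 2.

Definition bump (z : 'rV[R]_n) : R := flat 0 (gauge z).

Lemma smooth_bump (U : set 'rV[R]_n) : open U -> smooth_on U bump.
Proof.
move=> oU k; apply: Ck_flat => // {}k.
have cC (r : R) : Ck k U (cst r) by exact: Ck_cst.
rewrite (_ : gauge = fun z => e ^+ 2 +
    (-1) * \sum_i (z 0 i + - c 0 i) * (z 0 i + - c 0 i)).
  apply: Ck_add => //; first exact: cC.
  apply: Ck_mul => //; first exact: cC.
  apply: Ck_sum => // i.
  have zi : Ck k U (fun z : 'rV[R]_n => z 0 i).
    exact: (Ck_mxP _ _ oU).1 (@Ck_id _ _ _ _) 0 i.
  have zc : Ck k U (fun z : 'rV[R]_n => z 0 i + - c 0 i).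
    by apply: Ck_add => //; exact: cC.
  exact: Ck_mul.
by apply/funext => z; rewrite mulN1r.
Qed.

Lemma bump_center : 0 < e -> bump c != 0.
Proof.
move=> e0; rewrite /bump /flat /gauge big1 => [|i _]; last by rewrite subrr expr0n.
by rewrite subr0 exprn_gt0// expr0 mul1r gt_eqF// expR_gt0.
Qed.

Lemma bump_support z : 0 < e -> bump z != 0 ->
  forall i, c 0 i - e <= z 0 i <= c 0 i + e.
Proof.
move=> e0 + i; rewrite /bump; have [s0|s0 _] := lerP (gauge z) 0.
  by rewrite flat_le0// eqxx.
rewrite -ler_distl -ler_sqr ?nnegrE ?(ltW e0)// real_normK ?num_real//.
move: s0; rewrite subr_gt0 => /ltW; apply: le_trans.
by rewrite (bigD1 i)//= lerDl sumr_ge0// => j _; rewrite sqr_ge0.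
Qed.

End Cutoff.

Section ManifoldCutoff.
Context {R : realType} {Q : topologicalType} {n : nat} (A : atlas R Q n).
Hypothesis mA : smooth_manifold A.
Let sA := smooth_manifold_atlas mA.

Lemma coord_box (a : chart A) x : dom a x -> exists2 e : R, 0 < e &
  [set z : 'rV[R]_n | forall i, coord a x 0 i - e <= z 0 i <= coord a x 0 i + e]
    `<=` coord_range a.
Proof.
move=> ax; have : coord_range a (coord a x) by exists x.
move=> /(conj (@open_coord_range _ _ _ _ sA a))/open_nbhs_nbhs.
move=> /nbhs_ballP[e /= e0 He].
exists (e / 2); first by rewrite divr_gt0.
move=> z Hz; apply: He; split=> // i j; rewrite ord1.
have := Hz j; rewrite -ler_distl distrC => /le_lt_trans; apply.
by rewrite ltr_pdivrMr// ltr_pMr// ltr1n.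
Qed.

(** The part of the chart a lying over the compact K is compact, hence closed in
    the Hausdorff space Q.  If it met every neighbourhood of y, the traces
    of these neighbourhoods would cluster, in coordinates, at a point of K; by
    separation that point comes from y, although y is outside the chart. *)
Lemma near_outside_chart_compact (a : chart A) (K : set 'rV[R]_n) y :
  compact K -> K `<=` coord_range a -> ~ dom a y ->
  \forall x \near y, ~ (dom a x /\ K (coord a x)).
Proof.
move=> cK Ka nay; have [[hQ _] _ oinj opn _] := mA.
apply: contrapT => nfar; pose N := [set x | dom a x /\ K (coord a x)].
have clN : closure N y.
  move=> B yB; apply: contrapT => BN; apply: nfar; apply: filterS yB => x Bx Nx.
  by apply: BN; exists x.
have PF : ProperFilter (within N (nbhs y)) by exact: within_nbhs_proper.
have [|k [Kk kcl]] := cK (coord a @ within N (nbhs y)) _.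
  by apply: (@filterE _ (nbhs y)) => x [].
have [x ax xk] := Ka k Kk; apply: nay; rewrite (hQ y x)// => B C yB xC.
have [oa _] := oinj a.
have BN : (coord a @ within N (nbhs y)) (coord a @` (B `&` N)).
  by apply: filterS yB => u Bu Nu; exists u.
have kC : nbhs k (coord a @` (C^° `&` dom a)).
  apply: open_nbhs_nbhs; split.
    by apply/(opn a); [exact: subIsetr|apply: openI => //; exact: open_interior].
  by exists x.
have [_ [[u [Bu [au _]] <-] [v [Cv av] vu]]] := kcl _ _ BN kC.
exists u; split=> //; suff -> : u = v by exact: interior_subset.
by case: (oinj a) => _ inj; apply: inj; rewrite ?mem_set.
Qed.

(** A bump in the coordinates of a, supported in a cube contained in the range of
    the chart; compactness of the cube keeps it away from the rest of Q. *)
Lemma manifold_cutoff (a : chart A) x : dom a x ->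
  exists2 rho, cutoff a rho & rho x != 0.
Proof.
move=> ax; have [e e0 Ke] := coord_box ax; set K := (X in X `<=` _) in Ke.
pose h := bump (coord a x) e.
pose rho y := if `[< dom a y >] then h (coord a y) else 0.
have rhoT y : dom a y -> rho y = h (coord a y) by move=> ay; rewrite /rho asboolT.
have rhoN y : ~ (dom a y /\ K (coord a y)) -> rho y = 0.
  rewrite /rho; case: asboolP => // ay nK; apply: contrapT => /eqP h0.
  by apply: nK; split=> //; exact: bump_support e0 h0.
have cK : compact K.
  apply: (@rV_compact _ _
    (fun i => [set` `[coord a x 0 i - e, coord a x 0 i + e]])) => i.
  exact: segment_compact.
have [_ _ oinj opn _] := mA.
have far b z : coord_range b z -> ~ overlap b a z ->
    \forall y \near z, localrep rho b y = 0.
  move=> [y yb <-] nba; have nay : ~ dom a y by move=> ay; apply: nba; exists y.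
  have [ob _] := oinj b.
  have := near_outside_chart_compact cK Ke nay.
  rewrite -nbhs_nearE nbhsE => -[N [oN Ny] NK].
  have oW : open (coord b @` (N `&` dom b)).
    by apply/(opn b); [exact: subIsetr|exact: openI].
  have : (coord b @` (N `&` dom b)) (coord b y) by exists y.
  move=> /(conj oW)/open_nbhs_nbhs; apply: filterS => _ [u [Nu bu] <-].
  by apply: etrans (localrep_coord sA rho bu) _; apply: rhoN; exact: NK.
exists rho; last by rewrite rhoT// bump_center.
split=> // b k; apply: Ck_local => z bz; have [oz|noz] := pselect (overlap b a z).
  exists (overlap b a) => //.
  have oba := @open_overlap _ _ _ _ sA b a.
  apply: (@smooth_ext _ _ _ _ (h \o transition b a)) => //.
    move=> _ [y [yb ya] <-] /=; rewrite (transition_coord sA a yb).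
    by apply: esym; apply: etrans (localrep_coord sA rho yb) _; exact: rhoT.
  apply: (smooth_comp_scalar oba (O := setT)) => //.
    exact: smooth_transition.
  exact/smooth_bump/openT.
have := far b z bz noz; rewrite -nbhs_nearE nbhsE => -[N [oN Nz] N0].
exists N => //; apply: (@Ck_ext _ _ _ _ _ (cst 0)) => // [y Ny|]; last exact: Ck_cst.
by rewrite N0.
Qed.

End ManifoldCutoff.

(** * Tangent and cotangent bundles *)

Section Bundle.
Context {R : realType} {M E : Type} {m : nat} (A : atlas R M m).
Context (pi : E -> M) (comp : E -> chart A -> 'rV[R]_m).
Context (g : chart A -> chart A -> 'rV[R]_m -> 'M[R]_m).

(** Both [tangent_atlas] and [cotangent_atlas] are of this form by definition,
    with pi the base point and comp the fibre components written as a row. *)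
Definition bundle_atlas : atlas R E (m + m) :=
  {| chart := chart A;
     dom := fun a t => dom a (pi t);
     coord := fun a t => row_mx (coord a (pi t)) (comp t a) |}.

Hypothesis sA : smooth_atlas A.
Hypothesis smooth_g : forall a b, smooth_on (overlap a b) (g a b).
Hypothesis comp_change : forall t a b, dom a (pi t) -> dom b (pi t) ->
  comp t b = comp t a *m g a b (coord a (pi t)).
Hypothesis comp_inj : forall s t a, dom a (pi s) -> pi s = pi t ->
  comp s a = comp t a -> s = t.
Hypothesis comp_surj : forall a x v, dom a x ->
  exists2 t, pi t = x & comp t a = v.

Local Notation B := bundle_atlas.

Lemma bundle_overlap (a b : chart A) z :
  @overlap _ _ _ B a b z <-> overlap a b (lsubmx z).
Proof.
split=> [[t [ta tb] <-]|[x [xa xb] xz]]; first by rewrite row_mxKl; exists (pi t).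
have [t tx tv] := @comp_surj a x (rsubmx z) xa.
by exists t; rewrite /= ?tx// xz tv hsubmxK.
Qed.

Lemma bundle_coord_range (a : chart A) z :
  @coord_range _ _ _ B a z <-> coord_range a (lsubmx z).
Proof. by rewrite -!overlapxx; exact: bundle_overlap. Qed.

Lemma bundle_transition (a b : chart A) z : overlap a b (lsubmx z) ->
  @transition _ _ _ B a b z =
  row_mx (transition a b (lsubmx z)) (rsubmx z *m g a b (lsubmx z)).
Proof.
move=> [x [ax bx] xz]; apply: localrep_eq => [|t ta tz].
  by apply/bundle_coord_range; exists x.
have tx : pi t = x.
  have [inj _ _] := sA; apply: (inj a); rewrite ?mem_set//.
  by rewrite xz -tz row_mxKl.
rewrite /= -xz (transition_coord sA b ax) tx (comp_change (a := a)) ?tx//.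
by rewrite -tz /= row_mxKr.
Qed.

Lemma smooth_bundle_atlas : smooth_atlas B.
Proof.
have oB (a b : chart A) : open (@overlap _ _ _ B a b).
  rewrite (_ : overlap _ _ = lsubmx @^-1` overlap a b).
    apply: open_comp => [z _|]; first exact: continuous_lsubmx.
    exact: open_overlap.
  by apply/seteqP; split=> z /bundle_overlap.
pose F (a b : chart A) z :=
  row_mx (transition a b (lsubmx z)) (rsubmx z *m g a b (lsubmx z)).
split=> // [a s t|].
  rewrite !inE => sa ta /eq_row_mx[st cst]; apply: (comp_inj sa) => //.
  by have [inj _ _] := sA; apply: (inj a); rewrite ?mem_set.
change (forall a b : chart A,
  smooth_on (@overlap _ _ _ B a b) (@transition _ _ _ B a b)).
move=> a b; apply: (@smooth_ext _ _ _ _ (F a b)) => //.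
  by move=> z /bundle_overlap zab; exact/esym/bundle_transition.
have oA := @open_overlap _ _ _ _ sA a b.
have inA z : @overlap _ _ _ B a b z -> overlap a b (lsubmx z).
  by move=> /bundle_overlap.
have sl := @smooth_lsubmx R m m _ (oB a b).
apply: smooth_row_mx => //.
  exact: smooth_comp (oB a b) oA inA sl (smooth_transition sA _ _).
apply: smooth_mulmx => //; first exact/smooth_rsubmx.
exact: smooth_comp (oB a b) oA inA sl (smooth_g a b).
Qed.

Lemma bundle_cutoff (a : chart A) rho :
  cutoff a rho -> @cutoff _ _ _ B a (rho \o pi).
Proof.
move=> [srho rho0].
have loc (b : chart A) z : @coord_range _ _ _ B b z ->
    @localrep _ _ _ B _ (rho \o pi) b z = localrep rho b (lsubmx z).
  move=> bz; apply: localrep_eq => // t bt <- /=; rewrite row_mxKl.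
  exact/esym/localrep_coord.
have sB := smooth_bundle_atlas.
split=> [b|b z bz nz].
  have oB := @open_coord_range _ _ _ _ sB b.
  apply: (@smooth_ext _ _ _ _ (@localrep _ _ _ A _ rho b \o lsubmx)) => //.
    by move=> z bz; rewrite loc.
  apply: (smooth_comp_scalar oB _ _ (srho b)).
    by move=> z /bundle_coord_range.
  exact: smooth_lsubmx oB.
have nl : ~ @overlap _ _ _ A b a (lsubmx z) by move=> /bundle_overlap.
have bl : @coord_range _ _ _ A b (lsubmx z) by exact/bundle_coord_range.
have near0 : \forall y \near z, @localrep _ _ _ A _ rho b (lsubmx y) = 0.
  exact: (@continuous_lsubmx R 1 m m z _ (rho0 b _ bl nl)).
have nearB := open_nbhs_nbhs (conj (@open_coord_range _ _ _ _ sB b) bz).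
by apply: filterS2 near0 nearB => y /= y0 yb; rewrite loc.
Qed.

End Bundle.

Section TangentCotangent.
Context {R : realType} {M : Type} {m : nat} (A : atlas R M m).
Hypothesis sA : smooth_atlas A.

Lemma tangent_eq (s t : tangent A) a : dom a (tbase s) -> tbase s = tbase t ->
  tcomp s a = tcomp t a -> s = t.
Proof.
move: s t => [x v vE vout] [y w wE wout] /= ax xy; subst y => vw.
have e : v = w.
  apply/funext => b; have [bx|nbx] := pselect (dom b x).
    by rewrite (vE a b) // (wE a b) // vw.
  by rewrite vout // wout.
by subst w; congr Tangent; exact: Prop_irrelevance.
Qed.

Lemma tangent_ex a x (v : 'rV[R]_m) : dom a x ->
  exists2 t : tangent A, tbase t = x & tcomp t a = v.
Proof.
move=> ax.
have [c [cT cout]] : exists c : chart A -> 'rV[R]_m,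
    (forall b, dom b x -> c b = v *m jacobian (transition a b) (coord a x)) /\
    (forall b, ~ dom b x -> c b = 0).
  exists (fun b => if `[< dom b x >] then
    v *m jacobian (transition a b) (coord a x) else 0).
  by split=> b bx; [rewrite asboolT|rewrite asboolF].
have cE b b' : dom b x -> dom b' x ->
    c b' = c b *m jacobian (transition b b') (coord b x).
  move=> bx bx'; rewrite (cT _ bx) (cT _ bx') -mulmxA; congr (_ *m _).
  exact: jacobian_transition_cocycle.
exists (Tangent cE cout) => //=.
by rewrite (cT _ ax) jacobian_transition_id// mulmx1.
Qed.

Lemma cotangent_eq (s t : cotangent A) a : dom a (cbase s) -> cbase s = cbase t ->
  (ccomp s a)^T = (ccomp t a)^T -> s = t.
Proof.
move: s t => [x v vE vout] [y w wE wout] /= ax xy; subst y => /trmx_inj vw.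
have e : v = w.
  apply/funext => b; have [bx|nbx] := pselect (dom b x).
    by rewrite (vE b a) // (wE b a) // vw.
  by rewrite vout // wout.
by subst w; congr Cotangent; exact: Prop_irrelevance.
Qed.

Lemma cotangent_ex a x (v : 'rV[R]_m) : dom a x ->
  exists2 t : cotangent A, cbase t = x & (ccomp t a)^T = v.
Proof.
move=> ax.
have [c [cT cout]] : exists c : chart A -> 'cV[R]_m,
    (forall b, dom b x -> c b = jacobian (transition b a) (coord b x) *m v^T) /\
    (forall b, ~ dom b x -> c b = 0).
  exists (fun b => if `[< dom b x >] then
    jacobian (transition b a) (coord b x) *m v^T else 0).
  by split=> b bx; [rewrite asboolT|rewrite asboolF].
have cE b b' : dom b x -> dom b' x ->
    c b = jacobian (transition b b') (coord b x) *m c b'.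
  move=> bx bx'; rewrite (cT _ bx).
  rewrite (cT _ bx').
  have cab := jacobian_transition_cocycle sA bx bx' ax.
  apply: etrans (congr1 (mulmx^~ v^T) cab) _.
  exact: esym (mulmxA _ _ _).
exists (Cotangent cE cout) => //=.
by rewrite (cT _ ax) jacobian_transition_id// mul1mx trmxK.
Qed.

(** The inverse transpose of the Jacobian of the transition, as covectors are
    turned into rows; writing it with the reverse transition avoids inverses. *)
Definition cotangent_cocycle (a b : chart A) (z : 'rV[R]_m) : 'M[R]_m :=
  (jacobian (transition b a) (transition a b z))^T.

Lemma cotangent_change (t : cotangent A) a b : dom a (cbase t) -> dom b (cbase t) ->
  (ccomp t b)^T = (ccomp t a)^T *m cotangent_cocycle a b (coord a (cbase t)).
Proof.
move=> ta tb; rewrite -trmx_mul (transition_coord sA b ta); congr (_^T).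
exact: ccompE.
Qed.

Lemma smooth_jacobian_transition (a b : chart A) :
  smooth_on (overlap a b) (jacobian (transition a b)).
Proof.
by apply: smooth_jacobian; [exact: open_overlap|exact: smooth_transition].
Qed.

Lemma smooth_cotangent_cocycle (a b : chart A) :
  smooth_on (overlap a b) (cotangent_cocycle a b).
Proof.
have oA := @open_overlap _ _ _ _ sA.
apply: smooth_trmx => //; apply: smooth_comp (oA a b) (oA b a) _ _ _.
- move=> _ [x [ax bx] <-]; rewrite (transition_coord sA b ax).
  by exists x.
- exact: smooth_transition.
- exact: smooth_jacobian_transition.
Qed.

Lemma smooth_tangent_atlas : smooth_atlas (tangent_atlas A).
Proof.
exact: (smooth_bundle_atlas sA smooth_jacobian_transition (@tcompE _ _ _ A)
  tangent_eq tangent_ex).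
Qed.

Lemma smooth_cotangent_atlas : smooth_atlas (cotangent_atlas A).
Proof.
exact: (smooth_bundle_atlas sA smooth_cotangent_cocycle cotangent_change
  cotangent_eq cotangent_ex).
Qed.

Lemma tangent_cutoff (a : chart A) rho : cutoff a rho ->
  @cutoff _ _ _ (tangent_atlas A) a (rho \o @tbase _ _ _ A).
Proof.
exact: (bundle_cutoff sA smooth_jacobian_transition (@tcompE _ _ _ A)
  tangent_eq tangent_ex).
Qed.

Lemma cotangent_cutoff (a : chart A) rho : cutoff a rho ->
  @cutoff _ _ _ (cotangent_atlas A) a (rho \o @cbase _ _ _ A).
Proof.
exact: (bundle_cutoff sA smooth_cotangent_cocycle cotangent_change
  cotangent_eq cotangent_ex).
Qed.

End TangentCotangent.

(** * Partial derivatives and semibasic forms *)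

Section Partials.
Context {R : realType}.

Lemma partial_lsubmxl n m (h : 'rV[R]_n -> R) (y : 'rV[R]_(n + m)) i :
  differentiable h (lsubmx y) ->
  partial (lshift m i) (fun y => h (lsubmx y)) y = partial i h (lsubmx y).
Proof.
move=> dh; have dl := @differentiable_lsubmx R 1 n m y.
rewrite /partial (deriveE _ (differentiable_comp dl dh)) (diff_comp dl dh) /=.
rewrite diff_lin; last exact: continuous_lsubmx.
have e0 : lsubmx (delta_mx 0 (lshift m i)) = delta_mx 0 i :> 'rV[R]_n.
  by apply/rowP => k; rewrite !mxE eqxx /= eq_lshift.
by apply: etrans (congr1 ('d h (lsubmx y)) e0) _; rewrite (deriveE _ dh).
Qed.

Lemma partial_lsubmxr n m (h : 'rV[R]_n -> R) (y : 'rV[R]_(n + m)) i :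
  differentiable h (lsubmx y) ->
  partial (rshift n i) (fun y => h (lsubmx y)) y = 0.
Proof.
move=> dh; have dl := @differentiable_lsubmx R 1 n m y.
rewrite /partial (deriveE _ (differentiable_comp dl dh)) (diff_comp dl dh) /=.
rewrite diff_lin; last exact: continuous_lsubmx.
have e0 : lsubmx (delta_mx 0 (rshift n i)) = 0 :> 'rV[R]_n.
  by apply/rowP => k; rewrite !mxE eqxx /= eq_lrshift.
by apply: etrans (congr1 ('d h (lsubmx y)) e0) _; rewrite linear0.
Qed.

Lemma partial_coord n (y : 'rV[R]_n) i j :
  partial i (fun y : 'rV[R]_n => y 0 j) y = (i == j)%:R.
Proof.
have := @derive_mx R _ 1 n id y (delta_mx 0 i) (@derivable_id _ _ _ _).
rewrite derive_id => /(congr1 (fun M : 'rV_n => M 0 j)).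
by rewrite !mxE eqxx /= eq_sym.
Qed.

Lemma jacobianE n m (f : 'rV[R]_n -> 'rV[R]_m) y : differentiable f y ->
  jacobian f y = \matrix_(i, j) partial i (fun y => f y 0 j) y.
Proof.
move=> df; apply/matrixP => i j; rewrite [RHS]mxE.
have := row_jacobian i df; rewrite /partial derive_mx; last exact: diff_derivable.
by move=> /(congr1 (fun M : 'rV_m => M 0 j)); rewrite mxE => ->; rewrite mxE.
Qed.

End Partials.

Section SemibasicForms.
Context {R : realType} {M : Type} {n : nat} (B : atlas R M (n + n)).

(** The differential of a form N_j dq^j. *)
Lemma d1_semibasic (alpha : form1 B) (a : chart B) z
    (N : 'rV[R]_(n + n) -> 'cV[R]_n) :
  (\forall y \near z, alpha a y = col_mx (N y) 0) ->
  let G := \matrix_(i, j) partial (lshift n i) (fun y => N y j 0) z in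
  let K := \matrix_(i, j) partial (rshift n i) (fun y => N y j 0) z in
  d1 alpha a z = block_mx (G - G^T) (- K^T) K 0.
Proof.
move=> aN G K.
have pl i j : partial i (fun y => alpha a y (lshift n j) 0) z =
    partial i (fun y => N y j 0) z.
  by apply: near_eq_derive; apply: filterS aN => y ->; rewrite col_mxEu.
have pr i j : partial i (fun y => alpha a y (rshift n j) 0) z = 0.
  rewrite -[RHS](derive_cst (0 : R) z (delta_mx 0 i)).
  by apply: near_eq_derive; apply: filterS aN => y ->; rewrite col_mxEd mxE.
apply/matrixP => i j; rewrite mxE.
case: (split_ordP i) => i' ->; case: (split_ordP j) => j' ->.
- by rewrite !pl block_mxEul !mxE.
- by rewrite pl pr block_mxEur !mxE sub0r.
- by rewrite pl pr block_mxEdl !mxE subr0.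
- by rewrite !pr block_mxEdr !mxE subr0.
Qed.

End SemibasicForms.

(** Congruence by D = [[1, A], [0, H]] is the pullback of 2-forms along a map
    (q, u) |-> (q, P (q, u)).  The inner matrix is the one of the differential of
    (J p)_i dq^i, where G gathers the derivatives of J; for J = 1 and G = 0 it is
    the one of d theta. *)
Lemma block_symplectic_pullback (R : comNzRingType) n (A H G J : 'M[R]_n) :
  let D := block_mx 1%:M A 0 H in
  D *m block_mx (G - G^T) (- J) J^T 0 *m D^T =
  block_mx ((G + A *m J^T) - (G + A *m J^T)^T) (- (H *m J^T)^T) (H *m J^T) 0.
Proof.
move=> D; rewrite /D tr_block_mx trmx1 trmx0 !mulmx_block.
rewrite !(mul1mx, mul0mx, mulmx0, mulmx1, addr0, add0r).
rewrite linearD /= !trmx_mul trmxK !mulNmx opprD.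
by rewrite !addrA (addrAC G) .
Qed.

(** * The two defining equations in a chart *)

Section CoordinateExpressions.
Context {R : realType} {Q : topologicalType} {n : nat} (A : atlas R Q n).
Local Notation TQ := (tangent_atlas A).
Local Notation T'Q := (cotangent_atlas A).
Variables (L : tangent A -> R) (J : tensor11 A).
Hypothesis mA : smooth_manifold A.
Hypothesis sL : smooth_function TQ L.
Hypothesis tJ : is_tensor11 J.

Let sA := smooth_manifold_atlas mA.
Let sTQ := smooth_tangent_atlas sA.

Lemma tangent_coord_range (a : chart A) z :
  @coord_range _ _ _ TQ a z -> coord_range a (lsubmx z).
Proof. by move=> [t ta <-]; rewrite row_mxKl; exists (tbase t). Qed.

Lemma near_coord_range (a : chart A) z : @coord_range _ _ _ TQ a z ->
  \forall y \near z, @coord_range _ _ _ TQ a y.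
Proof.
by move=> az; exact: open_nbhs_nbhs (conj (@open_coord_range _ _ _ _ sTQ a) az).
Qed.

Lemma differentiable_fibre_derivative (a : chart A) z j :
  @coord_range _ _ _ TQ a z ->
  differentiable (fun y => fibre_derivative L a y j 0) z.
Proof.
move=> az; rewrite (_ : (fun y => _) =
  partial (rshift n j) (@localrep _ _ _ TQ _ L a)).
  exact: smooth_differentiable (smooth_derive _ (sL a)) az.
by apply/funext => y; rewrite mxE.
Qed.

Lemma differentiable_tensor (a : chart A) q i j : coord_range a q ->
  differentiable (fun x => J a x i j) q.
Proof.
move=> aq; have [sJ _] := tJ; have oa := @open_coord_range _ _ _ _ sA a.
exact: smooth_differentiable ((smooth_mxP _ oa).1 (sJ a) i j) aq.
Qed.

(** The block of mixed second derivatives of L, with the base index first. *)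
Definition mixed_hessian (a : chart A) z : 'M[R]_n :=
  \matrix_(i, j) partial (lshift n i) (fun y => fibre_derivative L a y j 0) z.

Lemma fibre_hessianE (a : chart A) z : fibre_hessian L a z =
  \matrix_(i, j) partial (rshift n i) (fun y => fibre_derivative L a y j 0) z.
Proof.
apply/matrixP => i j; rewrite !mxE; congr (partial _ _ z).
by apply/funext => y; rewrite mxE.
Qed.

Lemma dS_semibasic (a : chart A) z :
  dK vertical_endo L (a : chart TQ) z = col_mx (fibre_derivative L a z) 0.
Proof.
rewrite /dK /coapply11 /vertical_endo -[d0 _ _ _]vsubmxK mul_block_col.
rewrite !mul0mx mul1mx !add0r; congr col_mx.
by apply/colP => i; rewrite !mxE.
Qed.

(** J^c S kills vertical vectors and sends d/dq^i to J^c (d/du^i), so its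
    matrix is read off from J^c on vertical lifts. *)
Lemma vertical_clift (Jc : tensor11 TQ) (a : chart A) z :
  is_tangent_clift J Jc -> @coord_range _ _ _ TQ a z ->
  (vertical_endo : tensor11 TQ) a z *m Jc a z = block_mx 0 (J a (lsubmx z)) 0 0.
Proof.
move=> [_ JcX] az; have [x ax xz] := tangent_coord_range az.
have JcE : dsubmx (Jc a z) = row_mx 0 (J a (lsubmx z)).
  have [rho crho rx] := manifold_cutoff mA ax.
  apply: (eq_on_vfields sA ax crho rx) => X vX.
  have [_ /(_ a z az)] := JcX X vX; rewrite /apply11 /vlift xz.
  rewrite -[Jc a z in LHS]vsubmxK mul_row_col mul0mx add0r => ->.
  by rewrite mul_mx_row mulmx0.
rewrite -[Jc a z]vsubmxK JcE /vertical_endo /= -[usubmx _]hsubmxK -!block_mxEv.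
by rewrite mulmx_block !(mul0mx, mul1mx, add0r, addr0).
Qed.

Lemma dJcS_semibasic (Jc : tensor11 TQ) (a : chart A) z :
  is_tangent_clift J Jc -> @coord_range _ _ _ TQ a z ->
  dK (comp11 Jc vertical_endo) L (a : chart TQ) z =
  col_mx (J a (lsubmx z) *m fibre_derivative L a z) 0.
Proof.
move=> cJ az; rewrite /dK /coapply11 /comp11 vertical_clift//.
rewrite -[d0 _ _ _]vsubmxK mul_block_col !mul0mx !add0r; congr (col_mx (_ *m _) _).
by apply/colP => i; rewrite !mxE.
Qed.

Lemma Legendre_localrep (Leg : tangent A -> cotangent A) (a : chart A) z :
  is_legendre L Leg -> @coord_range _ _ _ TQ a z ->
  bundle_localrep Leg a z = row_mx (lsubmx z) (fibre_derivative L a z)^T.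
Proof.
move=> lL az; apply: localrep_eq => // t ta tz; have [tb tc] := lL t.
by rewrite /= tb (tc _ ta) -tz row_mxKl.
Qed.

Lemma jacobian_Legendre (Leg : tangent A -> cotangent A) (a : chart A) z :
  is_legendre L Leg -> @coord_range _ _ _ TQ a z ->
  jacobian (bundle_localrep Leg a) z =
  block_mx 1%:M (mixed_hessian a z) 0 (fibre_hessian L a z).
Proof.
move=> lL az.
pose phi y := row_mx (lsubmx y) (fibre_derivative L a y)^T.
have near_phi : \forall y \near z, phi y = bundle_localrep Leg a y.
  apply: filterS (near_coord_range az) => y ay.
  by rewrite (Legendre_localrep lL ay).
have dphi : differentiable phi z.
  have oz := @open_coord_range _ _ _ _ sTQ a.
  apply: smooth_differentiable az; apply: smooth_row_mx => //.
    exact: smooth_lsubmx.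
  apply: smooth_trmx => //; apply/smooth_mxP => // i j.
  rewrite (_ : (fun y => _) = partial (rshift n i) (@localrep _ _ _ TQ _ L a)).
    exact: smooth_derive (sL a).
  by apply/funext => y; rewrite mxE.
rewrite -(jacobian_near near_phi dphi) jacobianE// fibre_hessianE.
apply/matrixP => i j; rewrite [LHS]mxE.
have pl i' j' : partial i' (fun y => phi y 0 (lshift n j')) z = (i' == lshift n j')%:R.
  rewrite -(partial_coord z); congr (partial _ _ z); apply/funext => y.
  by rewrite row_mxEl mxE.
have pr i' j' : partial i' (fun y => phi y 0 (rshift n j')) z =
    partial i' (fun y => fibre_derivative L a y j' 0) z.
  by congr (partial _ _ z); apply/funext => y; rewrite row_mxEr mxE.
case: (split_ordP i) => i' ->; case: (split_ordP j) => j' ->.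
- by rewrite pl block_mxEul mxE eq_lshift.
- by rewrite pr block_mxEur mxE.
- by rewrite pl block_mxEdl mxE eq_rlshift.
- by rewrite pr block_mxEdr mxE.
Qed.

(** The derivative of J p in q at fixed p. *)
Definition dJ_contraction (a : chart A) (q : 'rV[R]_n) (p : 'cV[R]_n) : 'M[R]_n :=
  \matrix_(i, j) \sum_k partial i (fun x => J a x j k) q * p k 0.

Lemma partial_tensor_apply (a : chart A) z i (P : 'rV[R]_(n + n) -> 'cV[R]_n) j :
  coord_range a (lsubmx z) -> (forall k, differentiable (fun y => P y k 0) z) ->
  partial i (fun y => (J a (lsubmx y) *m P y) j 0) z =
  \sum_k (J a (lsubmx z) j k * partial i (fun y => P y k 0) z
          + partial i (fun y => J a (lsubmx y) j k) z * P z k 0).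
Proof.
move=> az dP.
have dJ k : differentiable (fun y : 'rV[R]_(n + n) => J a (lsubmx y) j k) z.
  apply: (@differentiable_comp _ _ _ _ (@lsubmx R 1 n n) (fun x => J a x j k)).
    exact: differentiable_lsubmx.
  exact: differentiable_tensor.
have der k := @deriveM _ _ _ _ _ (delta_mx 0 i)
  (diff_derivable (dJ k)) (diff_derivable (dP k)).
pose F k : 'rV[R]_(n + n) -> R := (fun y => J a (lsubmx y) j k) * (fun y => P y k 0).
have -> : (fun y => (J a (lsubmx y) *m P y) j 0) = \sum_k F k.
  by apply/funext => y; rewrite mxE fct_sumE.
rewrite /partial derive_sum; last first.
  by move=> k; apply: derivableM; exact: diff_derivable.
by apply: eq_bigr => k _; rewrite der [P z k 0 *: _]mulrC.
Qed.

Lemma d_dS (a : chart A) z :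
  d1 (dK vertical_endo L) (a : chart TQ) z =
  block_mx (mixed_hessian a z - (mixed_hessian a z)^T)
    (- (fibre_hessian L a z)^T) (fibre_hessian L a z) 0.
Proof.
rewrite fibre_hessianE; apply: d1_semibasic.
by apply: filterE => y; exact: dS_semibasic.
Qed.

Lemma d_dJcS (Jc : tensor11 TQ) (a : chart A) z :
  is_tangent_clift J Jc -> @coord_range _ _ _ TQ a z ->
  let H := fibre_hessian L a z in
  let G := dJ_contraction a (lsubmx z) (fibre_derivative L a z) in
  let K := mixed_hessian a z *m (J a (lsubmx z))^T in
  d1 (dK (comp11 Jc vertical_endo) L) (a : chart TQ) z =
  block_mx ((G + K) - (G + K)^T) (- (H *m (J a (lsubmx z))^T)^T)
    (H *m (J a (lsubmx z))^T) 0.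
Proof.
move=> cJ az H G K; have aq := tangent_coord_range az.
have dP k := differentiable_fibre_derivative k az.
have JPl i j : partial (lshift n i)
    (fun y => (J a (lsubmx y) *m fibre_derivative L a y) j 0) z = (G + K) i j.
  rewrite partial_tensor_apply// big_split [LHS]addrC !mxE; congr (_ + _).
    apply: eq_bigr => k _; congr (_ * _).
    by apply: (partial_lsubmxl (h := fun x => J a x j k)); exact: differentiable_tensor.
  by apply: eq_bigr => k _; rewrite !mxE mulrC.
have JPr i j : partial (rshift n i)
    (fun y => (J a (lsubmx y) *m fibre_derivative L a y) j 0) z =
    (H *m (J a (lsubmx z))^T) i j.
  rewrite partial_tensor_apply// mxE; apply: eq_bigr => k _.
  rewrite (partial_lsubmxr (h := fun x => J a x j k)); last exact: differentiable_tensor.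
  by rewrite mul0r addr0 /H fibre_hessianE !mxE mulrC.
apply: etrans (d1_semibasic _) _.
  by apply: filterS (near_coord_range az) => y ay; exact: dJcS_semibasic cJ ay.
congr (block_mx (_ - _^T) (- _^T) _ _).
- by apply/matrixP => i j; rewrite [LHS]mxE JPl.
- by apply/matrixP => i j; rewrite [LHS]mxE JPl.
- by apply/matrixP => i j; rewrite [LHS]mxE JPr.
- by apply/matrixP => i j; rewrite [LHS]mxE JPr.
Qed.

Lemma d_canonical_form (a : chart A) (z : 'rV[R]_(n + n)) :
  d1 (@canonical_form _ _ _ A) (a : chart T'Q) z = block_mx 0 (- 1%:M) 1%:M 0.
Proof.
apply: etrans (@d1_semibasic _ _ _ T'Q _ a z (fun y => (rsubmx y)^T) _) _.
  exact: filterE.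
have pr i j : partial i (fun y : 'rV[R]_(n + n) => (rsubmx y)^T j 0) z =
    (i == rshift n j)%:R.
  rewrite -(partial_coord z); congr (partial _ _ z); apply/funext => y.
  by rewrite !mxE.
have E0 : \matrix_(i, j) partial (lshift n i)
    (fun y : 'rV[R]_(n + n) => (rsubmx y)^T j 0) z = 0.
  by apply/matrixP => i j; rewrite [LHS]mxE pr eq_lrshift mxE.
have E1 : \matrix_(i, j) partial (rshift n i)
    (fun y : 'rV[R]_(n + n) => (rsubmx y)^T j 0) z = 1%:M.
  by apply/matrixP => i j; rewrite [LHS]mxE pr eq_rshift mxE.
by rewrite E0 E1 trmx0 subr0 trmx1.
Qed.

(** The matrix of d theta being constant, the Lie derivative along J^v only
    involves the first derivatives of J^v = (J p)_j d/dp_j. *)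
Lemma lie_canonical_form (a : chart A) (z : 'rV[R]_(n + n)) :
  coord_range a (lsubmx z) ->
  let G := dJ_contraction a (lsubmx z) (rsubmx z)^T in
  lie2 (covlift J) (d1 (@canonical_form _ _ _ A)) (a : chart T'Q) z =
  block_mx (G - G^T) (- J a (lsubmx z)) (J a (lsubmx z))^T 0.
Proof.
move=> az G; pose W : 'M[R]_(n + n) := block_mx 0 (- 1%:M) 1%:M 0.
pose DX : 'M[R]_(n + n) :=
  \matrix_(i, k) partial i (fun y => covlift J (a : chart T'Q) y 0 k) z.
have -> : lie2 (covlift J) (d1 (@canonical_form _ _ _ A)) (a : chart T'Q) z =
    DX *m W + W *m DX^T.
  apply/matrixP => i j; rewrite [RHS]mxE [X in X + _]mxE [X in _ + X]mxE [LHS]mxE.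
  rewrite -big_split; apply: eq_bigr => k _ /=.
  rewrite d_canonical_form -/W.
  rewrite (_ : (fun y => _) = cst (W i j)); last first.
    by apply/funext => y; rewrite d_canonical_form.
  by rewrite /partial derive_cst mulr0 add0r !mxE [X in X + _]mulrC.
have -> : DX = block_mx 0 G 0 (J a (lsubmx z))^T.
  have pl i j : partial i (fun y => covlift J (a : chart T'Q) y 0 (lshift n j)) z = 0.
    rewrite -[RHS](derive_cst (0 : R) z (delta_mx 0 i)); congr (partial _ _ z).
    by apply/funext => y; rewrite row_mxEl mxE.
  have dr k : differentiable (fun y : 'rV[R]_(n + n) => (rsubmx y)^T k 0) z.
    rewrite (_ : (fun y => _) = fun y : 'rV[R]_(n + n) => y 0 (rshift n k)).
      exact: differentiable_coord.
    by apply/funext => y; rewrite !mxE.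
  have prs i k : partial i (fun y : 'rV[R]_(n + n) => (rsubmx y)^T k 0) z =
      (i == rshift n k)%:R.
    rewrite -(partial_coord z); congr (partial _ _ z); apply/funext => y.
    by rewrite !mxE.
  have pr i j : partial i (fun y => covlift J (a : chart T'Q) y 0 (rshift n j)) z =
    \sum_k (J a (lsubmx z) j k * (i == rshift n k)%:R +
      partial i (fun y => J a (lsubmx y) j k) z * (rsubmx z)^T k 0).
    under [RHS]eq_bigr do rewrite -prs.
    rewrite -partial_tensor_apply//; congr (partial _ _ z); apply/funext => y.
    by rewrite row_mxEr -[in RHS](trmxK (J a _)) -trmx_mul [RHS]mxE.
  apply/matrixP => i j; rewrite [LHS]mxE.
  case: (split_ordP i) => i' ->; case: (split_ordP j) => j' ->.
  - by rewrite pl block_mxEul mxE.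
  - rewrite pr block_mxEur mxE; apply: eq_bigr => k _.
    rewrite eq_lrshift mulr0 add0r; congr (_ * _).
    by apply: (partial_lsubmxl (h := fun x => J a x j' k)); exact: differentiable_tensor.
  - by rewrite pl block_mxEdl mxE.
  - rewrite pr block_mxEdr mxE (bigD1 i')//= big1 ?addr0 => [|k ki].
      rewrite eqxx mulr1 (partial_lsubmxr (h := fun x => J a x j' i')) ?mul0r ?addr0//.
      exact: differentiable_tensor.
    rewrite eq_rshift eq_sym (negbTE ki) mulr0 add0r.
    rewrite (partial_lsubmxr (h := fun x => J a x j' k)) ?mul0r//.
    exact: differentiable_tensor.
rewrite /W tr_block_mx !mulmx_block.
rewrite !(trmx0, mul0mx, mulmx0, mulmx1, mul1mx, addr0, add0r).
rewrite add_block_mx.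
by rewrite !(mulNmx, mulmxN, mul1mx, mulmx1, trmxK, addr0, add0r, oppr0).
Qed.

End CoordinateExpressions.

(** * The comparison of R with the lift of J *)

Theorem proposition6 (R : realType) (n : nat) (Q : topologicalType)
    (A : atlas R Q n) (L : tangent A -> R) (J : tensor11 A)
    (Jc RL : tensor11 (tangent_atlas A)) (Jt : tensor11 (cotangent_atlas A))
    (Leg : tangent A -> cotangent A) :
  smooth_manifold A ->
  smooth_function (tangent_atlas A) L ->
  regular L ->
  is_tensor11 J ->
  is_tangent_clift J Jc ->
  is_cotangent_clift J Jt ->
  is_legendre L Leg ->
  is_tensor11 RL ->
  (forall xi : vfield (tangent_atlas A), is_vfield xi ->
     same_field (contract2 (apply11 RL xi) (d1 (dK vertical_endo L)))
                (contract2 xi (d1 (dK (comp11 Jc vertical_endo) L)))) ->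
  same_field RL (pullback11 Leg Jt).
Proof.
move=> mA sL regL tJ cJ [_ cJt] lL _ RLE a.
(* The charts of TQ are those of Q. *)
change (chart A) in (type of a) => z az.
have sA := smooth_manifold_atlas mA.
have [t ta tz] := az.
(* One cut-off function on Q around the base point of t serves for TQ at t and
   for T*Q at Leg t. *)
have [rho crho rx] := manifold_cutoff mA ta.
have [tb tc] := lL t.
pose zeta := bundle_localrep Leg a z.
have zetaE : zeta = row_mx (lsubmx z) (fibre_derivative L a z)^T.
  exact: Legendre_localrep lL az.
have zetaL : coord (a : chart (cotangent_atlas A)) (Leg t) = zeta.
  by rewrite zetaE /= tb (tc _ ta) -tz row_mxKl.
have tLa : dom (a : chart (cotangent_atlas A)) (Leg t) by rewrite /= tb.
pose D := jacobian (bundle_localrep Leg a) z.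
have DE : D = block_mx 1%:M (mixed_hessian L a z) 0 (fibre_hessian L a z).
  exact (jacobian_Legendre mA sL lL az).
have uD : D \in unitmx.
  by rewrite DE unitmxE det_ublock det1 mul1r -unitmxE; exact: regL az.
pose W : 'M[R]_(n + n) := block_mx 0 (- 1%:M) 1%:M 0.
pose Lam := lie2 (covlift J) (d1 (@canonical_form _ _ _ A))
  (a : chart (cotangent_atlas A)) zeta.
have uW : W \in unitmx.
  have /mulmx1_unit[] : W *m (- W) = 1%:M.
    rewrite mulmxN mulmx_block !(mul0mx, mulmx0, mulmx1, mul1mx, add0r, addr0).
    by rewrite opp_block_mx opprK oppr0 scalar_mx_block.
  by [].
have JtE : Jt a zeta *m W = Lam.
  have sT := smooth_cotangent_atlas sA.
  have rL : (rho \o @cbase _ _ _ A) (Leg t) != 0 by rewrite /= tb.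
  apply: (eq_on_vfields sT tLa (cotangent_cutoff sA crho) rL) => X vX.
  have zr : @coord_range _ _ _ (cotangent_atlas A) a zeta by exists (Leg t).
  have /trmx_inj := cJt X vX a zeta zr.
  by rewrite zetaL /apply11 d_canonical_form -mulmxA.
have RLd : RL a z *m d1 (dK vertical_endo L) a z =
    d1 (dK (comp11 Jc vertical_endo) L) a z.
  have sT := smooth_tangent_atlas sA.
  apply: (eq_on_vfields sT ta (tangent_cutoff sA crho) rx) => X vX.
  have /trmx_inj := RLE X vX a z az.
  by rewrite /apply11 tz -mulmxA.
(* When J is the identity, (J p)_i dq^i is the canonical form. *)
have pullW : D *m W *m D^T = d1 (dK vertical_endo L) a z.
  rewrite DE d_dS.
  have := block_symplectic_pullback (mixed_hessian L a z)
    (fibre_hessian L a z) 0 1%:M.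
  by rewrite trmx0 trmx1 subr0 !mulmx1 !add0r.
have pullLam : D *m Lam *m D^T = d1 (dK (comp11 Jc vertical_endo) L) a z.
  have zl : lsubmx zeta = lsubmx z by rewrite zetaE row_mxKl.
  have zr : (rsubmx zeta)^T = fibre_derivative L a z.
    by rewrite zetaE row_mxKr trmxK.
  have aq : @coord_range _ _ _ A a (lsubmx zeta).
    by rewrite zl; exact: tangent_coord_range az.
  rewrite DE /Lam (lie_canonical_form mA tJ aq) zl zr (d_dJcS mA sL tJ cJ az).
  exact: block_symplectic_pullback.
rewrite /pullback11 -/D -/zeta; apply: (canRL (mulmxK uD)).
apply: (can_inj (mulmxK uW)); apply: (can_inj (mulmxK (_ : D^T \in unitmx))).
  by rewrite unitmx_tr.
by rewrite -[D *m _ *m W]mulmxA JtE pullLam -RLd -pullW !mulmxA.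
Qed.
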